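(* Let $G$ be an uncountable abelian Polish group. Then there is a set $X\subseteq G$ which is naively Haar meager but not Haar meager.
   Context: Let $G$ be a Polish group. A set $A\subseteq G$ is called Haar meager if there exist a Borel set $B\subseteq G$ with $A\subseteq B$, a compact metric space $K$, and a continuous map $f\colon K\to G$ such that $f^{-1}(gBh)$ is meager in $K$ for every $g,h\in G$. A set $X\subseteq G$ is called naively Haar meager if there are a compact metrizable space $K$ and a continuous map $f\colon K\to G$ such that $f^{-1}(gXh)$ is meager in $K$ for every $g,h\in G$ (no Borel hull is required). *)

(* Defs.v *)
From Stdlib Require Import Reals List.
Open Scope R_scope.

Definition is_metric {X : Type} (d : X -> X -> R) : Prop :=
  (forall x y, 0 <= d x y) /\
  (forall x y, d x y = 0 <-> x = y) /\
  (forall x y, d x y = d y x) /\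
  (forall x y z, d x z <= d x y + d y z).

Definition subset {X : Type} (A B : X -> Prop) : Prop := forall x, A x -> B x.

Definition is_open {X : Type} (d : X -> X -> R) (U : X -> Prop) : Prop :=
  forall x, U x -> exists eps, 0 < eps /\ forall y, d x y < eps -> U y.

Definition closure {X : Type} (d : X -> X -> R) (A : X -> Prop) : X -> Prop :=
  fun x => forall eps, 0 < eps -> exists y, A y /\ d x y < eps.

Definition interior {X : Type} (d : X -> X -> R) (A : X -> Prop) : X -> Prop :=
  fun x => exists U, is_open d U /\ U x /\ subset U A.

Definition nowhere_dense {X : Type} (d : X -> X -> R) (A : X -> Prop) : Prop :=
  forall x, ~ interior d (closure d A) x.

Definition meager {X : Type} (d : X -> X -> R) (A : X -> Prop) : Prop :=
  exists N : nat -> (X -> Prop),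
    (forall n, nowhere_dense d (N n)) /\
    (forall x, A x -> exists n, N n x).

Inductive borel {X : Type} (d : X -> X -> R) : (X -> Prop) -> Prop :=
  | borel_open : forall U, is_open d U -> borel d U
  | borel_compl : forall A, borel d A -> borel d (fun x => ~ A x)
  | borel_union : forall A : nat -> (X -> Prop),
      (forall n, borel d (A n)) -> borel d (fun x => exists n, A n x)
  | borel_ext : forall A B, borel d A -> (forall x, A x <-> B x) -> borel d B.

Definition compact {X : Type} (d : X -> X -> R) : Prop :=
  forall (I : Type) (U : I -> X -> Prop),
    (forall i, is_open d (U i)) ->
    (forall x, exists i, U i x) ->
    exists l : list I, forall x, exists i, In i l /\ U i x.

Definition continuous {X Y : Type} (dX : X -> X -> R) (dY : Y -> Y -> R)
  (f : X -> Y) : Prop :=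
  forall x eps, 0 < eps -> exists delta, 0 < delta /\
    forall x', dX x x' < delta -> dY (f x) (f x') < eps.

Definition cauchy {X : Type} (d : X -> X -> R) (u : nat -> X) : Prop :=
  forall eps, 0 < eps -> exists N, forall m n, (N <= m)%nat -> (N <= n)%nat ->
    d (u m) (u n) < eps.

Definition converges {X : Type} (d : X -> X -> R) (u : nat -> X) (l : X) : Prop :=
  forall eps, 0 < eps -> exists N, forall n, (N <= n)%nat -> d (u n) l < eps.

Definition complete {X : Type} (d : X -> X -> R) : Prop :=
  forall u, cauchy d u -> exists l, converges d u l.

Definition separable {X : Type} (d : X -> X -> R) : Prop :=
  exists s : nat -> X, forall x eps, 0 < eps -> exists n, d x (s n) < eps.

(** * Polish groups
    A topological group whose topology is Polish, i.e. given by some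
    complete separable metric d (d need not be invariant). *)
Record PolishGroup : Type := {
  pg_carrier :> Type;
  pg_mul : pg_carrier -> pg_carrier -> pg_carrier;
  pg_inv : pg_carrier -> pg_carrier;
  pg_one : pg_carrier;
  pg_mulA : forall x y z, pg_mul x (pg_mul y z) = pg_mul (pg_mul x y) z;
  pg_mul1l : forall x, pg_mul pg_one x = x;
  pg_mul1r : forall x, pg_mul x pg_one = x;
  pg_mulVl : forall x, pg_mul (pg_inv x) x = pg_one;
  pg_mulVr : forall x, pg_mul x (pg_inv x) = pg_one;
  pg_dist : pg_carrier -> pg_carrier -> R;
  pg_metric : is_metric pg_dist;
  pg_complete : complete pg_dist;
  pg_separable : separable pg_dist;
  pg_mul_cont : forall x y eps, 0 < eps -> exists delta, 0 < delta /\
    forall x' y', pg_dist x x' < delta -> pg_dist y y' < delta ->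
      pg_dist (pg_mul x y) (pg_mul x' y') < eps;
  pg_inv_cont : continuous pg_dist pg_dist pg_inv
}.

Definition abelian (G : PolishGroup) : Prop :=
  forall x y : G, pg_mul G x y = pg_mul G y x.

(** uncountable: no map from nat onto G (G is nonempty) *)
Definition uncountable (G : PolishGroup) : Prop :=
  ~ exists s : nat -> G, forall x : G, exists n, s n = x.

Definition translate (G : PolishGroup) (g h : G) (X : G -> Prop) : G -> Prop :=
  fun y => exists x, X x /\ y = pg_mul G (pg_mul G g x) h.

Definition witness_meager (G : PolishGroup) (X : G -> Prop) : Prop :=
  exists (K : Type) (dK : K -> K -> R) (f : K -> G),
    is_metric dK /\ compact dK /\ inhabited K /\
    continuous dK (pg_dist G) f /\
    forall g h : G, meager dK (fun k => translate G g h X (f k)).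

Definition haar_meager (G : PolishGroup) (A : G -> Prop) : Prop :=
  exists B : G -> Prop, borel (pg_dist G) B /\ subset A B /\
    witness_meager G B.

Definition naively_haar_meager (G : PolishGroup) (X : G -> Prop) : Prop :=
  witness_meager G X.

(* Main.v *)
(**
Fix continuous maps [p], [q] from the Cantor space to [G], with [p] injective,
such that each translate of [P - P] (where [P] is the image of [p]) meets each
translate of the image of [q] in at most one point.  Such maps are obtained as
subset sums of a rapidly vanishing sequence of [G], the even terms being used
for [p] and the odd ones for [q].

If [B] is Borel with witness [f : K -> G], then by Kuratowski-Ulam some [k] in
[K] satisfies [f k + q y] outside [B] for comeagerly many [y].  It is therefore
enough that [X] meets every set [k + q(D)] with [D] a countable intersection of
dense open sets.  There are at most continuum many such sets, each has size
continuum, and a transfinite recursion picks a point in each of them so that no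
two picked points differ by an element of [P - P]; at each stage every earlier
point excludes at most one candidate.  Then every translate of [X] meets [P] in
at most one point, so that [p] witnesses that [X] is naively Haar meager.
*)

From mathcomp Require classical.boolp classical.wochoice.
From Stdlib Require Import Reals List Lra Lia Cantor.
From Stdlib Require Import Wellfounded Classical ClassicalEpsilon FunctionalExtensionality.
Require Import Defs.

(** * Transfinite choice *)

Definition injective {A B : Type} (f : A -> B) : Prop :=
  forall x y, f x = f y -> x = y.

Lemma well_founded_total_order (T : Type) :
  exists lt : T -> T -> Prop,
    well_founded lt /\ forall x y, lt x y \/ x = y \/ lt y x.
Proof.
revert T.
(* The well-ordering principle speaks of types with a boolean equality; [boolp.Peq] reduces an
   arbitrary type to that case. *)
apply (@boolp.Peq (fun T : Type => exists lt : T -> T -> Prop,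
  well_founded lt /\ forall x y, lt x y \/ x = y \/ lt y x)).
intros T.
destruct (wochoice.well_ordering_principle T) as [r Hr].
assert (Hmin : forall P : eqtype.Equality.sort T -> Prop, (exists x, P x) ->
  exists z, (P z /\ forall y, P y -> r z y = true) /\
    forall z', P z' -> (forall y, P y -> r z' y = true) -> z = z').
{ intros P [x Px].
  destruct (Hr (fun t => boolp.asbool (P t))) as [z [[Pz Lz] Uz]].
  { exists x. exact (boolp.asboolT Px). }
  exists z; split; [split|].
  - exact (boolp.asboolW Pz).
  - intros y Py. exact (Lz y (boolp.asboolT Py)).
  - intros z' Pz' Lz'. apply Uz. split.
    + exact (boolp.asboolT Pz').
    + intros y Py. exact (Lz' y (boolp.asboolW Py)). }
(* The strict part of the well-order [r], as the negation of its converse. *)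
exists (fun x y => r y x <> true); split.
- intros x. apply NNPP. intros Hx.
  destruct (Hmin (fun t => ~ Acc (fun x y => r y x <> true) t)
    (ex_intro _ x Hx)) as [z [[Hz Lz] _]].
  apply Hz. constructor. intros y Hy. apply NNPP. intros Hy'.
  exact (Hy (Lz y Hy')).
- intros x y.
  assert (Hrefl : forall t, r t t = true).
  { intros t. destruct (Hmin (fun s => s = t) (ex_intro _ t eq_refl))
      as [z [[Hz Lz] _]]. subst z. now apply Lz. }
  destruct (classic (r x y = true)) as [Hxy|Hxy]; [|now right; right].
  destruct (classic (r y x = true)) as [Hyx|Hyx]; [|now left].
  right; left.
  (* Antisymmetry: [x] and [y] are both least in the pair, and least elements are unique. *)
  destruct (Hmin (fun s => s = x \/ s = y) (ex_intro _ x (or_introl eq_refl)))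
    as [z [_ Uz]].
  transitivity z; [symmetry|]; apply Uz; try now left.
  + intros t [->| ->]; trivial.
  + now right.
  + intros t [->| ->]; trivial.
Qed.

(* [e] embeds [T] into an initial ordinal of the order [lt]. *)
Lemma small_initial_segments (T : Type) :
  exists (lt : T -> T -> Prop) (e : T -> T),
    well_founded lt /\ (forall x y, lt x y \/ x = y \/ lt y x) /\
    injective e /\
    forall t, ~ exists phi : T -> T, injective phi /\ forall s, lt (phi s) (e t).
Proof.
destruct (well_founded_total_order T) as [lt [Hwf Htot]].
set (big t := exists phi : T -> T, injective phi /\ forall s, lt (phi s) t).
exists lt.
destruct (classic (exists t, big t)) as [[t Ht]|Hnone].
(* At the least [t] below which [T] embeds, the embedding itself serves as [e]: its values lie below
   [t], so none of them is big. *)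
- induction t as [t IH] using (well_founded_ind Hwf).
  destruct (classic (exists s, lt s t /\ big s)) as [[s [Hst Hs]]|Hmin].
  + exact (IH s Hst Hs).
  + destruct Ht as [e [He Het]]. exists e.
    split; [exact Hwf|split; [exact Htot|split; [exact He|]]].
    intros u Hu. apply Hmin. exists (e u). now split.
- exists (fun t => t).
  split; [exact Hwf|split; [exact Htot|split; [now intros x y|]]].
  intros t Ht. apply Hnone. now exists t.
Qed.

(** Recursion along the rank [e (code i)]. If all the candidates [phi t] were excluded at stage [i],
    sending [t] to the rank of an earlier point that excludes [phi t] would inject [T] below
    [e (code i)], against the choice of [e]. *)
Lemma transversal (T I Y : Type) (code : I -> T) (A : I -> Y -> Prop)
  (R : Y -> Y -> Prop) :
  inhabited Y -> injective code ->
  (forall i, exists phi : T -> Y, injective phi /\ forall t, A i (phi t)) ->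
  (forall i z y1 y2, A i y1 -> A i y2 -> R z y1 -> R z y2 -> y1 = y2) ->
  (forall y z, R y z -> R z y) ->
  exists x : I -> Y, (forall i, A i (x i)) /\ forall i j, i <> j -> ~ R (x i) (x j).
Proof.
intros HY Hcode Hbig HR Hsym.
destruct (small_initial_segments T) as [lt [e [Hwf [Htot [He Hsmall]]]]].
set (rank i := e (code i)).
assert (Hrank : injective rank).
{ intros i j Hij. now apply Hcode, He. }
set (ltI i j := lt (rank i) (rank j)).
assert (HwfI : well_founded ltI) by exact (wf_inverse_image _ _ lt rank Hwf).
(* [epsilon] yields an arbitrary point when no candidate is admissible; [Hspec] rules this case
   out. *)
set (F := fun i (x : forall j, ltI j i -> Y) =>
  epsilon HY (fun y => A i y /\ forall j (h : ltI j i), ~ R (x j h) y)).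
set (x := Fix HwfI (fun _ => Y) F).
assert (Hx : forall i, x i =
  epsilon HY (fun y => A i y /\ forall j, ltI j i -> ~ R (x j) y)).
{ intros i. unfold x at 1. rewrite Fix_eq; [reflexivity|].
  intros j f g Hfg. f_equal. extensionality k. extensionality h. apply Hfg. }
assert (Hspec : forall i, A i (x i) /\ forall j, ltI j i -> ~ R (x j) (x i)).
{ intros i. rewrite (Hx i). apply epsilon_spec. apply NNPP. intros Hno.
  destruct (Hbig i) as [phi [Hphi HA]].
  assert (Hbad : forall t, exists j, ltI j i /\ R (x j) (phi t)).
  { intros t. apply NNPP. intros Ht. apply Hno. exists (phi t); split; auto.
    intros j Hj HRj. apply Ht. now exists j. }
  apply choice in Hbad. destruct Hbad as [j Hj].
  apply (Hsmall (code i)). exists (fun t => rank (j t)). split.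
  - intros s t Hst. apply Hrank in Hst. apply Hphi.
    apply (HR i (x (j s))); auto; [apply Hj|rewrite Hst; apply Hj].
  - intros s. apply Hj. }
exists x; split; [apply Hspec|].
intros i j Hij HRij.
destruct (Htot (rank i) (rank j)) as [H|[H|H]].
- now apply (proj2 (Hspec j) i).
- exact (Hij (Hrank _ _ H)).
- apply (proj2 (Hspec i) j); auto.
Qed.

(** * Category in metric spaces *)

Lemma inv_INR_S_pos (n : nat) : 0 < / (INR n + 1).
Proof. apply Rinv_0_lt_compat. pose proof (pos_INR n). lra. Qed.

Lemma inv_INR_S_le (m n : nat) : / (INR m + 1) <= / (INR n + 1) <-> (n <= m)%nat.
Proof.
pose proof (pos_INR m). pose proof (pos_INR n). split; intros H1.
- apply INR_le. apply Rnot_lt_le. intros H2.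
  assert (/ (INR n + 1) < / (INR m + 1)); [|lra].
  apply Rinv_lt_contravar; [nra|lra].
- apply le_INR in H1. apply Rinv_le_contravar; lra.
Qed.

Lemma inv_INR_S_small (eps : R) : 0 < eps -> exists n, / (INR n + 1) < eps.
Proof.
intros He. destruct (archimed_cor1 eps He) as [n [Hn Hn0]]. exists n.
apply lt_INR in Hn0. simpl in Hn0. eapply Rlt_trans; [|exact Hn].
apply Rinv_lt_contravar; nra.
Qed.

Definition open_dense {X : Type} (d : X -> X -> R) (U : X -> Prop) : Prop :=
  is_open d U /\
  forall V, is_open d V -> (exists x, V x) -> exists x, V x /\ U x.

(** Meagerness phrased through a comeager complement, the form that Baire arguments consume. *)
Definition thin {X : Type} (d : X -> X -> R) (A : X -> Prop) : Prop :=
  exists U : nat -> X -> Prop, (forall n, open_dense d (U n)) /\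
    forall x, (forall n, U n x) -> ~ A x.

Definition baire {X : Type} (d : X -> X -> R) : Prop :=
  forall U : nat -> X -> Prop, (forall n, open_dense d (U n)) ->
  forall V, is_open d V -> (exists x, V x) -> exists x, V x /\ forall n, U n x.

Definition countable_base {X : Type} (d : X -> X -> R) (b : nat -> X -> Prop) : Prop :=
  (forall n, is_open d (b n)) /\
  forall U x, is_open d U -> U x -> exists n, b n x /\ subset (b n) U.

Definition prod_dist {X Y : Type} (dX : X -> X -> R) (dY : Y -> Y -> R)
  (p q : X * Y) : R := Rmax (dX (fst p) (fst q)) (dY (snd p) (snd q)).

Lemma is_open_inter {X : Type} (d : X -> X -> R) (U V : X -> Prop) :
  is_open d U -> is_open d V -> is_open d (fun x => U x /\ V x).
Proof.
intros HU HV x [Ux Vx].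
destruct (HU x Ux) as [e [He HUe]]. destruct (HV x Vx) as [f [Hf HVf]].
exists (Rmin e f). split; [now apply Rmin_glb_lt|].
intros y Hy. split; [apply HUe|apply HVf];
  (eapply Rlt_le_trans; [exact Hy|]); [apply Rmin_l|apply Rmin_r].
Qed.

Lemma is_open_ball {X : Type} (d : X -> X -> R) (c : X) (r : R) :
  is_metric d -> is_open d (fun x => d c x < r).
Proof.
intros [_ [_ [_ Htri]]] x Hx. exists (r - d c x). split; [lra|].
intros y Hy. pose proof (Htri c x y). lra.
Qed.

Lemma meager_thin {X : Type} (d : X -> X -> R) (A : X -> Prop) :
  is_metric d -> meager d A -> thin d A.
Proof.
intros [Hpos [H0 [Hsym Htri]]] [N [HN HA]].
exists (fun n x => ~ closure d (N n) x). split.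
- intros n. split.
  + intros x Hx. apply not_all_ex_not in Hx. destruct Hx as [e He].
    apply imply_to_and in He. destruct He as [He Hno].
    exists (e / 2). split; [lra|]. intros y Hy Hcl. apply Hno.
    destruct (Hcl (e / 2)) as [z [Nz Hz]]; [lra|].
    exists z; split; trivial. pose proof (Htri x y z). lra.
  + intros V HV [x Vx]. apply NNPP. intros Hno. apply (HN n x).
    exists V. repeat split; trivial. intros y Vy. apply NNPP. intros Hy.
    apply Hno. now exists y.
- intros x Hx Ax. destruct (HA x Ax) as [n Nx]. apply (Hx n).
  intros e He. exists x. split; trivial.
  rewrite (proj2 (H0 x x)); trivial.
Qed.

(** * Countable bases and Baire category in compact metric spaces *)

Section CompactMetric.
Context {X : Type} (d : X -> X -> R) (Hd : is_metric d) (Hc : compact d).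

Lemma compact_countable_base : exists b, countable_base d b.
Proof.
destruct Hd as [Hpos [H0 [Hsym Htri]]].
assert (Hnet : forall n : nat, exists l : list X,
  forall x, exists c, In c l /\ d c x < / (INR n + 1)).
{ intros n. apply (Hc X (fun c x => d c x < / (INR n + 1))).
  - intros c. now apply is_open_ball.
  - intros x. exists x. rewrite (proj2 (H0 x x)); trivial.
    apply inv_INR_S_pos. }
apply choice in Hnet. destruct Hnet as [l Hl].
(* The index codes a radius and a position in the finite net for it; positions past the end of the
   net give the empty set. *)
exists (fun k => let (n, m) := of_nat k in
  match nth_error (l n) m with
  | Some c => fun x => d c x < / (INR n + 1)
  | None => fun _ => False
  end).
split.
- intros k. destruct (of_nat k) as [n m].
  destruct (nth_error (l n) m); [now apply is_open_ball|now intros x].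
- intros U x HU Ux. destruct (HU x Ux) as [e [He Hball]].
  destruct (inv_INR_S_small (e / 2)) as [n Hn]; [lra|].
  destruct (Hl n x) as [c [Hin Hcx]].
  apply In_nth_error in Hin. destruct Hin as [m Hm].
  exists (to_nat (n, m)). rewrite cancel_of_to, Hm. split; trivial.
  intros y Hy. apply Hball. pose proof (Htri x c y). rewrite (Hsym x c) in H. lra.
Qed.

Lemma compact_baire : baire d.
Proof.
destruct Hd as [Hpos [H0 [Hsym Htri]]].
intros U HU V HV [x Vx]. destruct (HV x Vx) as [r [Hr Hball]].
(* One step of a sequence of nested closed balls: the new ball lies inside the old one and inside
   [U n]. *)
assert (Hstep : forall np : nat * (X * R), exists q : X * R,
  let '(n, (c, s)) := np in 0 < s ->
  0 < snd q /\ forall y, d (fst q) y <= snd q -> d c y <= s /\ U n y).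
{ intros [n [c s]]. destruct (Rlt_dec 0 s) as [Hs|Hs].
  - destruct (HU n) as [Ho Hdense].
    destruct (Hdense (fun y => d c y < s)) as [z [Hz Uz]].
    { now apply is_open_ball. }
    { exists c. now rewrite (proj2 (H0 c c)). }
    destruct (is_open_inter d _ _ (is_open_ball d c s Hd) Ho z (conj Hz Uz))
      as [e [He Hze]].
    exists (z, e / 2). intros _. simpl. split; [lra|].
    intros y Hy. destruct (Hze y) as [H1 H2]; [lra|]. split; [lra|trivial].
  - exists (c, s). intros; lra. }
apply choice in Hstep. destruct Hstep as [F HF].
set (p := fix p n := match n with O => (x, r / 2) | S n => F (n, p n) end).
assert (Hp : forall n, 0 < snd (p n) /\
  forall y, d (fst (p (S n))) y <= snd (p (S n)) ->
    d (fst (p n)) y <= snd (p n) /\ U n y).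
{ induction n as [|n IH].
  - split; [simpl; lra|]. apply (HF (O, (x, r / 2))). lra.
  - assert (Hn : 0 < snd (p (S n))).
    { pose proof (HF (n, p n)) as H. cbn beta iota in H. simpl p.
      destruct (p n). now apply H. }
    split; [exact Hn|].
    pose proof (HF (S n, p (S n))) as H. change (p (S (S n))) with (F (S n, p (S n))).
    destruct (p (S n)). now apply H. }
assert (Hnest : forall m n y, (n <= m)%nat ->
  d (fst (p m)) y <= snd (p m) -> d (fst (p n)) y <= snd (p n)).
{ intros m n y Hnm. induction Hnm as [|m Hnm IH]; trivial.
  intros H. apply IH, Hp, H. }
(* If the closed balls had no common point, their complements would cover the space; but the centre
   of the ball of largest index in a finite subcover belongs to none of these complements. *)
assert (Hpt : exists y, forall n, d (fst (p n)) y <= snd (p n)).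
{ apply NNPP. intros Hno.
  destruct (Hc nat (fun n y => snd (p n) < d (fst (p n)) y)) as [l Hl].
  - intros n y Hy. exists (d (fst (p n)) y - snd (p n)). split; [lra|].
    intros z Hz. pose proof (Htri (fst (p n)) z y). rewrite (Hsym z y) in H. lra.
  - intros y. apply NNPP. intros Hy. apply Hno. exists y. intros n.
    apply Rnot_lt_le. intros Hn. apply Hy. now exists n.
  - set (N := list_max l). destruct (Hl (fst (p N))) as [n [Hin Hn]].
    apply (Rlt_not_le _ _ Hn). apply (Hnest N).
    + assert (HF' : Forall (fun k => (k <= N)%nat) l) by now apply list_max_le.
      rewrite Forall_forall in HF'. now apply HF'.
    + rewrite (proj2 (H0 _ _)); trivial. apply Rlt_le, Hp. }
destruct Hpt as [y Hy]. exists y. split.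
- apply Hball. specialize (Hy O). simpl in Hy. lra.
- intros n. now apply (Hp n).
Qed.

End CompactMetric.

(** * The sigma-ideal of thin sets and the Baire property *)

Lemma thin_union {X : Type} (d : X -> X -> R) (A : nat -> X -> Prop) :
  (forall n, thin d (A n)) -> thin d (fun x => exists n, A n x).
Proof.
intros H. apply choice in H. destruct H as [U HU].
exists (fun k => let (n, m) := of_nat k in U n m). split.
- intros k. destruct (of_nat k) as [n m]. apply HU.
- intros x Hx [n An]. apply (proj2 (HU n) x); trivial.
  intros m. specialize (Hx (to_nat (n, m))). now rewrite cancel_of_to in Hx.
Qed.

Lemma thin_subset {X : Type} (d : X -> X -> R) (A B : X -> Prop) :
  subset A B -> thin d B -> thin d A.
Proof.
intros HAB [U [HU HB]]. exists U. split; trivial.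
intros x Hx Ax. exact (HB x Hx (HAB x Ax)).
Qed.

Lemma thin_empty {X : Type} (d : X -> X -> R) (A : X -> Prop) :
  (forall x, ~ A x) -> thin d A.
Proof.
intros HA. exists (fun _ _ => True). split; [|now intros; apply HA].
intros _. split.
- intros x _. exists 1. split; [lra|trivial].
- intros V _ [x Vx]. now exists x.
Qed.

Lemma thin_union2 {X : Type} (d : X -> X -> R) (A B : X -> Prop) :
  thin d A -> thin d B -> thin d (fun x => A x \/ B x).
Proof.
intros HA HB.
apply thin_subset with (fun x => exists n : nat, match n with O => A | _ => B end x).
- intros x [Ax|Bx]; [now exists O|now exists 1%nat].
- apply thin_union. now intros [|n].
Qed.

(* The Banach category theorem. *)
Lemma thin_locally {X : Type} (d : X -> X -> R) (b : nat -> X -> Prop)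
  (A : X -> Prop) : countable_base d b ->
  (forall V, is_open d V -> (exists x, V x) -> exists W, is_open d W /\
    (exists x, W x) /\ subset W V /\ thin d (fun x => A x /\ W x)) ->
  thin d A.
Proof.
intros [Hbo Hb] Hloc.
(* The union of the basic open sets in which [A] is thin. The hypothesis makes it dense, so [A]
   splits into a part outside [U] and countably many thin pieces. *)
set (U x := exists n, b n x /\ thin d (fun x => A x /\ b n x)).
assert (HU : open_dense d U).
{ split.
  - intros x [n [bx Hn]]. destruct (Hbo n x bx) as [e [He Hball]].
    exists e. split; trivial. intros y Hy. exists n. split; auto.
  - intros V HV HVne. destruct (Hloc V HV HVne) as [W [HW [[x Wx] [HWV Hthin]]]].
    destruct (Hb W x HW Wx) as [n [bx HbW]]. exists x. split; [now apply HWV|].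
    exists n. split; trivial. revert Hthin. apply thin_subset.
    intros y [Ay By]. split; trivial. now apply HbW. }
apply thin_subset with (fun x => ~ U x \/
  exists n, A x /\ b n x /\ thin d (fun x => A x /\ b n x)).
- intros x Ax. destruct (classic (U x)) as [[n [bx Hn]]|Hx]; [right|now left].
  exists n. now repeat split.
- apply thin_union2.
  + exists (fun _ => U). split; [trivial|]. intros x Hx Hn. exact (Hn (Hx O)).
  + apply thin_union. intros n.
    destruct (classic (thin d (fun x => A x /\ b n x))) as [Hn|Hn].
    * revert Hn. apply thin_subset. intros x [H1 [H2 _]]. now split.
    * apply thin_empty. intros x [_ [_ H]]. exact (Hn H).
Qed.

(* Equivalent to the Baire property of [A], in a form that passes to
   complements for free. *)
Definition locally_decided {X : Type} (d : X -> X -> R) (A : X -> Prop) : Prop :=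
  forall V, is_open d V -> (exists x, V x) ->
  exists W, is_open d W /\ (exists x, W x) /\ subset W V /\
    (thin d (fun x => A x /\ W x) \/ thin d (fun x => ~ A x /\ W x)).

Lemma borel_locally_decided {X Y : Type} (dX : X -> X -> R) (dY : Y -> Y -> R)
  (b : nat -> X -> Prop) (f : X -> Y) (B : Y -> Prop) :
  countable_base dX b -> continuous dX dY f -> borel dY B ->
  locally_decided dX (fun x => B (f x)).
Proof.
intros Hb Hf HB.
induction HB as [U HU|A _ IH|A _ IH|A B _ IH HAB]; intros V HV [x Vx].
- destruct (classic (exists x, V x /\ U (f x))) as [HVU|HVU].
  + exists (fun x => V x /\ U (f x)). repeat split; trivial.
    * apply is_open_inter; trivial. intros y Uy.
      destruct (HU _ Uy) as [e [He Hball]].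
      destruct (Hf y e He) as [r [Hr Hcont]]. exists r. split; auto.
    * now intros y [Hy _].
    * right. apply thin_empty. tauto.
  + exists V. repeat split; trivial; [now exists x|now intros y|].
    left. apply thin_empty. intros y Hy. apply HVU. now exists y.
- destruct (IH V HV (ex_intro _ x Vx)) as [W [HW [Hne [HWV [H|H]]]]];
    exists W; repeat split; trivial.
  + right. revert H. apply thin_subset. intros y [H1 H2]. split; trivial. now apply NNPP.
  + now left.
(* If some [A n] is comeager in a nonempty open part of [V], so is the union. Otherwise the
   induction hypothesis leaves only the thin alternative inside [V], so each [A n] is thin in [V] by
   [thin_locally], and so is the union. *)
- destruct (classic (exists n W, is_open dX W /\ (exists x, W x) /\ subset W V /\
    thin dX (fun x => ~ A n (f x) /\ W x))) as [[n [W [HW [Hne [HWV H]]]]]|Hno].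
  + exists W. repeat split; trivial. right. revert H. apply thin_subset.
    intros y [H1 H2]. split; trivial. intros H3. apply H1. now exists n.
  + exists V. repeat split; trivial; [now exists x|now intros y|]. left.
    apply thin_subset with (fun x => exists n, A n (f x) /\ V x).
    { intros y [[n H1] H2]. now exists n. }
    apply thin_union. intros n. apply (thin_locally dX b); trivial.
    intros O HO [y Oy].
    destruct (classic (exists x, O x /\ V x)) as [HOV|HOV].
    * destruct (IH n (fun x => O x /\ V x)) as [W [HW [Hne [HWV [H|H]]]]]; trivial.
      { now apply is_open_inter. }
      { exists W. repeat split; trivial; [intros z Hz; now apply HWV|].
        revert H. apply thin_subset. intros z [[H1 _] H2]. now split. }
      { exfalso. apply Hno. exists n, W. repeat split; trivial.
        intros z Hz. now apply HWV. }
    * exists O. repeat split; trivial; [now exists y|now intros z|].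
      apply thin_empty. intros z [[_ Vz] Oz]. apply HOV. now exists z.
- destruct (IH V HV (ex_intro _ x Vx)) as [W [HW [Hne [HWV [H|H]]]]];
    exists W; repeat split; trivial; [left|right]; revert H; apply thin_subset;
    intros y; now rewrite HAB.
Qed.

(** * Products and their sections *)

Section Product.
Context {X Y : Type} (dX : X -> X -> R) (dY : Y -> Y -> R).

Lemma is_open_rectangle (U : X -> Prop) (V : Y -> Prop) :
  is_open dX U -> is_open dY V ->
  is_open (prod_dist dX dY) (fun p => U (fst p) /\ V (snd p)).
Proof.
intros HU HV [x y] [Ux Vy].
destruct (HU x Ux) as [e [He HUe]]. destruct (HV y Vy) as [f [Hf HVf]].
exists (Rmin e f). split; [now apply Rmin_glb_lt|].
intros [x' y'] H. unfold prod_dist in H. simpl in *.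
pose proof (Rmax_l (dX x x') (dY y y')). pose proof (Rmax_r (dX x x') (dY y y')).
pose proof (Rmin_l e f). pose proof (Rmin_r e f).
split; [apply HUe|apply HVf]; lra.
Qed.

Lemma open_contains_rectangle (W : X * Y -> Prop) (x : X) (y : Y) :
  is_metric dX -> is_metric dY -> is_open (prod_dist dX dY) W -> W (x, y) ->
  exists U V, is_open dX U /\ is_open dY V /\ U x /\ V y /\
    forall x' y', U x' -> V y' -> W (x', y').
Proof.
intros HX HY HW Wxy. destruct (HW _ Wxy) as [e [He Hball]].
exists (fun x' => dX x x' < e), (fun y' => dY y y' < e).
repeat split; try now apply is_open_ball.
- now rewrite (proj2 (proj1 (proj2 HX) x x)).
- now rewrite (proj2 (proj1 (proj2 HY) y y)).
- intros x' y' H1 H2. apply Hball. now apply Rmax_lub_lt.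
Qed.

Lemma prod_countable_base (bX : nat -> X -> Prop) (bY : nat -> Y -> Prop) :
  is_metric dX -> is_metric dY -> countable_base dX bX -> countable_base dY bY ->
  exists b, countable_base (prod_dist dX dY) b.
Proof.
intros HX HY [HbXo HbX] [HbYo HbY].
exists (fun k => let (i, j) := of_nat k in fun p => bX i (fst p) /\ bY j (snd p)).
split.
- intros k. destruct (of_nat k) as [i j]. now apply is_open_rectangle.
- intros W [x y] HW Wxy.
  destruct (open_contains_rectangle W x y HX HY HW Wxy)
    as [U [V [HU [HV [Ux [Vy HUV]]]]]].
  destruct (HbX U x HU Ux) as [i [bx Hi]]. destruct (HbY V y HV Vy) as [j [by_ Hj]].
  exists (to_nat (i, j)). rewrite cancel_of_to. split; [now split|].
  intros [x' y'] [H1 H2]. now apply HUV; [apply Hi|apply Hj].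
Qed.

(* Kuratowski-Ulam. *)
Lemma section_open_dense (b : nat -> Y -> Prop) (W : nat -> X * Y -> Prop)
  (U : X -> Prop) :
  is_metric dX -> is_metric dY -> baire dX -> countable_base dY b ->
  (forall n, open_dense (prod_dist dX dY) (W n)) ->
  is_open dX U -> (exists x, U x) ->
  exists x, U x /\ forall n, open_dense dY (fun y => W n (x, y)).
Proof.
intros HX HY Hbaire [Hbo Hb] HW HU HUne.
destruct (Hbaire (fun k => let (n, j) := of_nat k in
  fun x => (exists y, b j y) -> exists y, b j y /\ W n (x, y))) with (V := U)
  as [x [Ux Hx]]; trivial.
- intros k. destruct (of_nat k) as [n j].
  destruct (classic (exists y, b j y)) as [Hj|Hj].
  2:{ split.
      - intros x _. exists 1. split; [lra|]. intros x' _ H. destruct (Hj H).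
      - intros V _ [x Vx]. exists x. split; trivial. intros H. destruct (Hj H). }
  split.
  + intros x Hx. destruct (Hx Hj) as [y [by_ Wxy]].
    destruct (open_contains_rectangle (W n) x y HX HY (proj1 (HW n)) Wxy)
      as [O [V [HO [HV [Ox [Vy HOV]]]]]].
    destruct (HO x Ox) as [e [He Hball]]. exists e. split; trivial.
    intros x' Hx' _. exists y. split; trivial. apply HOV; trivial. now apply Hball.
  + intros V HV [x Vx]. destruct Hj as [y by_].
    destruct (proj2 (HW n) (fun p => V (fst p) /\ b j (snd p)))
      as [[x' y'] [[H1 H2] H3]].
    * now apply is_open_rectangle.
    * now exists (x, y).
    * exists x'. split; trivial. intros _. now exists y'.
- exists x. split; trivial. intros n. split.
  + intros y Wxy.
    destruct (open_contains_rectangle (W n) x y HX HY (proj1 (HW n)) Wxy)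
      as [O [V [HO [HV [Ox [Vy HOV]]]]]].
    destruct (HV y Vy) as [e [He Hball]]. exists e. split; trivial. auto.
  + intros V HV [y Vy]. destruct (Hb V y HV Vy) as [j [by_ Hj]].
    specialize (Hx (to_nat (n, j))). rewrite cancel_of_to in Hx.
    destruct Hx as [y' [H1 H2]]; [now exists y|]. exists y'. split; auto.
Qed.

End Product.

Lemma is_open_swap {X Y : Type} (dX : X -> X -> R) (dY : Y -> Y -> R)
  (W : X * Y -> Prop) : is_open (prod_dist dX dY) W ->
  is_open (prod_dist dY dX) (fun p => W (snd p, fst p)).
Proof.
intros HW [y x] Wxy. destruct (HW _ Wxy) as [e [He Hball]].
exists e. split; trivial. intros [y' x'] H. apply Hball.
unfold prod_dist in *. simpl in *. now rewrite Rmax_comm.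
Qed.

Lemma open_dense_swap {X Y : Type} (dX : X -> X -> R) (dY : Y -> Y -> R)
  (W : X * Y -> Prop) : open_dense (prod_dist dX dY) W ->
  open_dense (prod_dist dY dX) (fun p => W (snd p, fst p)).
Proof.
intros [HW Hdense]. split; [now apply is_open_swap|].
intros V HV [[y x] Vyx].
destruct (Hdense _ (is_open_swap _ _ V HV)) as [[x' y'] [H1 H2]].
- now exists (x, y).
- now exists (y', x').
Qed.

(** Kuratowski-Ulam is used in both directions. The preimage of [B] is thin in the product: by the
    Baire property it would otherwise be comeager in some open rectangle, hence so would one of its
    horizontal sections be in an open set, although that section is thin. A thin set in the product
    then has a thin vertical section. *)
Lemma borel_thin_section {X Y Z : Type} (dX : X -> X -> R) (dY : Y -> Y -> R)
  (dZ : Z -> Z -> R) (f : X * Y -> Z) (B : Z -> Prop) :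
  is_metric dX -> compact dX -> inhabited X -> is_metric dY -> compact dY ->
  continuous (prod_dist dX dY) dZ f -> borel dZ B ->
  (forall y, thin dX (fun x => B (f (x, y)))) ->
  exists x, thin dY (fun y => B (f (x, y))).
Proof.
intros HX HXc [x0] HY HYc Hf HB Hthin.
destruct (compact_countable_base dX HX HXc) as [bX HbX].
destruct (compact_countable_base dY HY HYc) as [bY HbY].
destruct (prod_countable_base dX dY bX bY HX HY HbX HbY) as [b Hb].
assert (HE : thin (prod_dist dX dY) (fun p => B (f p))).
{ apply (thin_locally _ b _ Hb). intros V HV HVne.
  destruct (borel_locally_decided _ dZ b f B Hb Hf HB V HV HVne)
    as [W [HW [[[x y] Wxy] [HWV [H|H]]]]].
  { exists W. repeat split; trivial. now exists (x, y). }
  exfalso. destruct H as [D [HD HDB]].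
  destruct (open_contains_rectangle dX dY W x y HX HY HW Wxy)
    as [U [P [HU [HP [Ux [Py HUP]]]]]].
  (* The coordinates are swapped in order to choose a horizontal section. *)
  destruct (section_open_dense dY dX bX (fun n p => D n (snd p, fst p)) P)
    as [y' [Py' HDy']]; trivial.
  { now apply compact_baire. }
  { intros n. now apply open_dense_swap. }
  { now exists y. }
  destruct (Hthin y') as [D' [HD' HDB']].
  (* Two sequences are merged into one: [D'] keeps [x'] out of the section of the preimage of [B] at
     [y'], while the sections of [D] force it in. *)
  destruct (compact_baire dX HX HXc (fun k => let (i, n) := of_nat k in
    match i with O => D' n | _ => fun x => D n (x, y') end)) with (V := U)
    as [x' [Ux' Hx']]; trivial.
  { intros k. destruct (of_nat k) as [[|i] n]; [apply HD'|exact (HDy' n)]. }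
  { now exists x. }
  apply (HDB (x', y')).
  - intros n. specialize (Hx' (to_nat (1%nat, n))). now rewrite cancel_of_to in Hx'.
  - split; [|now apply HUP]. apply HDB'. intros n.
    specialize (Hx' (to_nat (O, n))). now rewrite cancel_of_to in Hx'. }
destruct HE as [D [HD HDB]].
destruct (section_open_dense dX dY bY D (fun _ => True)) as [x [_ Hx]]; trivial.
- now apply compact_baire.
- intros z _. exists 1. split; [lra|trivial].
- now exists x0.
- exists x, (fun n y => D n (x, y)). split; trivial. intros y Hy. now apply HDB.
Qed.

(** * The Cantor space *)

Definition cantor : Type := nat -> bool.

Definition agree (n : nat) (x y : cantor) : Prop :=
  forall i, (i < n)%nat -> x i = y i.

Lemma first_difference (x y : cantor) :
  x <> y -> exists n, agree n x y /\ x n <> y n.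
Proof.
intros Hxy.
assert (Hn : exists n, x n <> y n).
{ apply not_all_ex_not. intros H. apply Hxy. now extensionality n. }
destruct Hn as [n Hn]. induction n as [n IH] using (well_founded_ind Wf_nat.lt_wf).
destruct (classic (agree n x y)) as [Ha|Ha]; [now exists n|].
apply not_all_ex_not in Ha. destruct Ha as [m Hm].
apply imply_to_and in Hm. destruct Hm as [Hm Hne]. now apply (IH m).
Qed.

Definition cantor_dist (x y : cantor) : R :=
  match excluded_middle_informative (x = y) with
  | left _ => 0
  | right H =>
    / (INR (proj1_sig (constructive_indefinite_description _ (first_difference x y H))) + 1)
  end.

Lemma cantor_dist_spec (x y : cantor) :
  (x = y /\ cantor_dist x y = 0) \/
  exists n, agree n x y /\ x n <> y n /\ cantor_dist x y = / (INR n + 1).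
Proof.
unfold cantor_dist.
destruct (excluded_middle_informative (x = y)) as [H|H]; [now left|right].
destruct (constructive_indefinite_description _ (first_difference x y H))
  as [n [Ha Hn]]. now exists n.
Qed.

Lemma agree_cantor_dist (n : nat) (x y : cantor) :
  agree n x y <-> cantor_dist x y <= / (INR n + 1).
Proof.
destruct (cantor_dist_spec x y) as [[-> ->]|[m [Ha [Hm ->]]]].
- split; [intros _; apply Rlt_le, inv_INR_S_pos|now intros _ i _].
- rewrite inv_INR_S_le. split; intros H.
  + apply Nat.nlt_ge. intros Hmn. now apply Hm, H.
  + intros i Hi. apply Ha. lia.
Qed.

Lemma cantor_metric : is_metric cantor_dist.
Proof.
assert (Hpos : forall x y, 0 <= cantor_dist x y).
{ intros x y. destruct (cantor_dist_spec x y) as [[_ ->]|[n [_ [_ ->]]]]; [lra|].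
  apply Rlt_le, inv_INR_S_pos. }
(* The ultrametric inequality, as a disjunction. *)
assert (Hle : forall x y z, cantor_dist x z <= cantor_dist x y \/
                           cantor_dist x z <= cantor_dist y z).
{ intros x y z.
  destruct (cantor_dist_spec x y) as [[-> _]|[n [Hn [_ Hxy]]]]; [now right; right|].
  destruct (cantor_dist_spec y z) as [[<- _]|[m [Hm [_ Hyz]]]]; [now left; right|].
  rewrite Hxy, Hyz, <- !agree_cantor_dist.
  destruct (Nat.le_ge_cases n m); [left|right]; intros i Hi;
    (rewrite Hn by lia); apply Hm; lia. }
assert (H0 : forall x, cantor_dist x x = 0).
{ intros x. destruct (cantor_dist_spec x x) as [[_ H]|[n [_ [H _]]]]; [exact H|].
  now elim H. }
split; [exact Hpos|split; [|split]].
- intros x y. split; [|now intros ->].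
  destruct (cantor_dist_spec x y) as [[H _]|[n [_ [_ ->]]]]; [now intros _|].
  pose proof (inv_INR_S_pos n). lra.
- intros x y. apply Rle_antisym.
  + destruct (Hle x x y) as [H|H]; [rewrite H0 in H|].
    * pose proof (Hpos y x). lra.
    * destruct (cantor_dist_spec y x) as [[-> _]|[n [Hn [_ Hyx]]]]; [right; trivial|].
      rewrite Hyx. apply agree_cantor_dist. intros i Hi. symmetry. now apply Hn.
  + destruct (cantor_dist_spec x y) as [[-> _]|[n [Hn [_ Hyx]]]]; [right; trivial|].
      rewrite Hyx. apply agree_cantor_dist. intros i Hi. symmetry. now apply Hn.
- intros x y z. pose proof (Hpos x y). pose proof (Hpos y z).
  destruct (Hle x y z); lra.
Qed.

Lemma cantor_open_iff (U : cantor -> Prop) :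
  is_open cantor_dist U <->
  forall x, U x -> exists n, forall y, agree n x y -> U y.
Proof.
split; intros H x Ux.
- destruct (H x Ux) as [e [He Hball]]. destruct (inv_INR_S_small e He) as [n Hn].
  exists n. intros y Hy. apply Hball. apply agree_cantor_dist in Hy. lra.
- destruct (H x Ux) as [n Hn]. exists (/ (INR n + 1)).
  split; [apply inv_INR_S_pos|]. intros y Hy. apply Hn, agree_cantor_dist. lra.
Qed.

Lemma agree_limit (x : nat -> cantor) (len : nat -> nat) :
  (forall n, (len n < len (S n))%nat) ->
  (forall n, agree (len n) (x n) (x (S n))) ->
  exists z, forall n, agree (len n) (x n) z.
Proof.
intros Hlen H.
assert (Hmono : forall m n, (n <= m)%nat ->
  (len n <= len m)%nat /\ agree (len n) (x n) (x m)).
{ intros m n Hnm. induction Hnm as [|m Hnm [IH1 IH2]]; [now split|].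
  specialize (Hlen m). split; [lia|]. intros i Hi.
  rewrite IH2 by trivial. apply H. lia. }
assert (Hlarge : forall i, (i < len (S i))%nat).
{ induction i as [|i IH]; [specialize (Hlen O); lia|specialize (Hlen (S i)); lia]. }
(* Bit [i] is read at stage [S i], where the settled prefix is already longer than [i]; at stage [i]
   it may have length exactly [i]. *)
exists (fun i => x (S i) i). intros n i Hi.
destruct (Nat.le_ge_cases n (S i)) as [Hn|Hn].
- now apply Hmono.
- symmetry. now apply (Hmono n (S i)).
Qed.

(** König's argument: a cylinder without a finite subcover has a half without one. The branch
    obtained this way has a limit, and the member of the cover containing it contains a whole
    cylinder of the branch. *)
Lemma cantor_compact : compact cantor_dist.
Proof.
intros I U HU Hcov.
set (bad n x := ~ exists l : list I, forall y, agree n x y -> exists i, In i l /\ U i y).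
apply NNPP. intros Hno.
assert (Hstep : forall p : nat * cantor, exists x',
  bad (fst p) (snd p) -> agree (fst p) (snd p) x' /\ bad (S (fst p)) x').
{ intros [n x]. simpl.
  set (ext b := fun i => if Nat.eq_dec i n then b else x i).
  assert (Hext : forall b, agree n x (ext b)).
  { intros b i Hi. unfold ext. destruct (Nat.eq_dec i n); [lia|trivial]. }
  destruct (classic (bad (S n) (ext true))) as [Ht|Ht]; [now exists (ext true)|].
  exists (ext false). intros Hbad. split; trivial. intros [l1 Hl1].
  apply NNPP in Ht. destruct Ht as [l2 Hl2]. apply Hbad. exists (l1 ++ l2).
  intros y Hy.
  assert (Hy' : agree (S n) (ext (y n)) y).
  { intros i Hi. unfold ext. destruct (Nat.eq_dec i n); [now subst|]. apply Hy. lia. }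
  destruct (y n); [destruct (Hl2 y Hy') as [i [Hi Uy]]|
    destruct (Hl1 y Hy') as [i [Hi Uy]]]; exists i; rewrite in_app_iff; auto. }
apply choice in Hstep. destruct Hstep as [F HF].
set (x := fix x n := match n with O => fun _ => true | S n => F (n, x n) end).
assert (Hbad : forall n, bad n (x n)).
{ induction n as [|n IH].
  - intros [l Hl]. apply Hno. exists l. intros y. apply Hl. intros i Hi. lia.
  - now apply (HF (n, x n)). }
destruct (agree_limit x (fun n => n)) as [z Hz].
- intros n. lia.
- intros n. now apply (HF (n, x n)).
- destruct (Hcov z) as [i Uz].
  destruct (proj1 (cantor_open_iff (U i)) (HU i) z Uz) as [n Hn].
  apply (Hbad n). exists (i :: nil). intros y Hy. exists i. split; [now left|].
  apply Hn. intros j Hj. rewrite <- (Hz n j Hj). now apply Hy.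
Qed.

(** There are no isolated points: flipping bit [n] of [x] stays in the given cylinder, and
    approximating both points from [A] on [S n] bits, so as to include bit [n], gives two distinct
    members of [A]. *)
Lemma cantor_subsingleton_meager (A : cantor -> Prop) :
  (forall x y, A x -> A y -> x = y) -> meager cantor_dist A.
Proof.
intros HA. exists (fun _ => A). split; [|now intros x Ax; exists O].
intros _ x [U [HU [Ux HUA]]].
destruct (proj1 (cantor_open_iff U) HU x Ux) as [n Hn].
set (y i := if Nat.eq_dec i n then negb (x n) else x i).
assert (Hy : agree n x y).
{ intros i Hi. unfold y. destruct (Nat.eq_dec i n); [lia|trivial]. }
destruct (HUA x Ux (/ (INR (S n) + 1))) as [x' [Ax' Hx']]; [apply inv_INR_S_pos|].
destruct (HUA y (Hn y Hy) (/ (INR (S n) + 1))) as [y' [Ay' Hy']]; [apply inv_INR_S_pos|].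
apply Rlt_le, agree_cantor_dist in Hx'. apply Rlt_le, agree_cantor_dist in Hy'.
rewrite (HA y' x' Ay' Ax') in Hy'.
specialize (Hx' n ltac:(lia)). specialize (Hy' n ltac:(lia)).
rewrite <- Hx' in Hy'. unfold y in Hy'.
destruct (Nat.eq_dec n n); [|easy]. now destruct (x n).
Qed.

(* Fusion along the binary tree: at level [n] the [n]-th bit of the argument is
   copied, then the prefix is extended into [U n]. *)
Lemma cantor_embeds_comeager (U : nat -> cantor -> Prop) :
  (forall n, open_dense cantor_dist (U n)) ->
  exists phi : cantor -> cantor, injective phi /\ forall x n, U n (phi x).
Proof.
intros HU.
assert (Hstep : forall q : (nat * bool) * (nat * cantor), exists r : nat * cantor,
  let '((n, b), (m, x)) := q in
  (m < fst r)%nat /\ agree m x (snd r) /\ snd r m = b /\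
  forall y, agree (fst r) (snd r) y -> U n y).
{ intros [[n b] [m x]].
  set (x' i := if Nat.eq_dec i m then b else x i).
  destruct (HU n) as [Ho Hdense].
  destruct (Hdense (agree (S m) x')) as [y [Hy Uy]].
  - apply cantor_open_iff. intros y Hy. exists (S m). intros z Hz i Hi.
    rewrite <- Hz by trivial. now apply Hy.
  - now exists x'.
  - rewrite cantor_open_iff in Ho. destruct (Ho y Uy) as [k Hk].
    (* This length covers the copied bit at position [m] and reaches a cylinder of [y] inside
       [U n]. *)
    exists (S m + k, y)%nat. simpl fst. simpl snd. split; [lia|split; [|split]].
    + intros i Hi. rewrite <- Hy by lia. unfold x'.
      destruct (Nat.eq_dec i m); [lia|trivial].
    + rewrite <- Hy by lia. unfold x'. now destruct (Nat.eq_dec m m).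
    + intros z Hz. apply Hk. intros i Hi. apply Hz. lia. }
apply choice in Hstep. destruct Hstep as [F HF].
set (s := fun a : cantor => fix s n :=
  match n with O => (O, fun _ => true) | S n => F ((n, a n), s n) end).
assert (Hs : forall a n, (fst (s a n) < fst (s a (S n)))%nat /\
  agree (fst (s a n)) (snd (s a n)) (snd (s a (S n))) /\
  snd (s a (S n)) (fst (s a n)) = a n /\
  forall y, agree (fst (s a (S n))) (snd (s a (S n))) y -> U n y).
{ intros a n. pose proof (HF ((n, a n), s a n)) as H.
  change (s a (S n)) with (F ((n, a n), s a n)).
  now destruct (s a n) as [m x]. }
assert (Hlim : forall a, exists z, forall n, agree (fst (s a n)) (snd (s a n)) z).
{ intros a. apply (agree_limit (fun n => snd (s a n)) (fun n => fst (s a n)));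
    intros n; apply Hs. }
apply choice in Hlim. destruct Hlim as [phi Hphi].
exists phi. split.
- intros a b Hab. apply NNPP. intros Hne.
  destruct (first_difference a b Hne) as [n [Hag Hn]]. apply Hn.
  (* Up to the first difference both constructions pass through the same states, so the differing
     bits are copied to the same position. *)
  assert (Hsn : forall m, (m <= n)%nat -> s a m = s b m).
  { induction m as [|m IH]; trivial. intros Hm. simpl.
    rewrite IH by lia. now rewrite Hag by lia. }
  specialize (Hsn n (le_n n)).
  destruct (Hs a n) as [Hla [_ [Ha _]]]. destruct (Hs b n) as [Hlb [_ [Hb _]]].
  rewrite <- Ha, <- Hb.
  rewrite (Hphi a (S n)) by trivial. rewrite (Hphi b (S n)) by trivial.
  now rewrite Hab, Hsn.
- intros a n. apply (Hs a n), Hphi.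
Qed.

(** Binary notation with a leading 1, which makes the length of the prefix recoverable. *)
Fixpoint prefix_code (n : nat) (x : cantor) : nat :=
  match n with
  | O => 1
  | S n => 2 * prefix_code n x + (if x n then 1 else 0)
  end.

Lemma prefix_code_pos (n : nat) (x : cantor) : (0 < prefix_code n x)%nat.
Proof. induction n as [|n IH]; simpl; lia. Qed.

Lemma prefix_code_inj (m n : nat) (x y : cantor) :
  prefix_code m x = prefix_code n y -> m = n /\ agree m x y.
Proof.
revert n. induction m as [|m IH]; intros [|n]; simpl; intros H.
- split; trivial. intros i Hi. lia.
- pose proof (prefix_code_pos n y). destruct (y n); lia.
- pose proof (prefix_code_pos m x). destruct (x m); lia.
- destruct (IH n) as [-> Ha]; [destruct (x m), (y n); lia|].
  split; trivial. intros i Hi. destruct (Nat.eq_dec i n) as [->|Hin].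
  + destruct (IH n) as [_ _]; destruct (x n), (y n); trivial; lia.
  + apply Ha. lia.
Qed.

(** A union of cylinders selected by a bit sequence; coding by bits is what bounds the number of
    open sets by the continuum. *)
Definition coded_open (c : nat -> bool) (x : cantor) : Prop :=
  exists m, c (prefix_code m x) = true.

Lemma open_coded (U : cantor -> Prop) :
  is_open cantor_dist U -> exists c, forall x, coded_open c x <-> U x.
Proof.
intros HU. rewrite cantor_open_iff in HU.
set (P k := exists m y, k = prefix_code m y /\ forall z, agree m y z -> U z).
exists (fun k => if excluded_middle_informative (P k) then true else false).
intros x. unfold coded_open. split.
- intros [m Hm]. destruct (excluded_middle_informative (P (prefix_code m x)))
    as [[n [y [Hk Hy]]]|]; [|easy].
  apply prefix_code_inj in Hk. destruct Hk as [-> Ha]. apply Hy.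
  intros i Hi. symmetry. now apply Ha.
- intros Ux. destruct (HU x Ux) as [n Hn]. exists n.
  destruct (excluded_middle_informative (P (prefix_code n x))) as [|H]; trivial.
  elim H. now exists n, x.
Qed.

(** * Lacunary sequences in Polish groups *)

Lemma list_uniform_radius {X : Type} (P : X -> R -> Prop) (l : list X) :
  (forall x r s, P x r -> 0 < s -> s <= r -> P x s) ->
  (forall x, In x l -> exists r, 0 < r /\ P x r) ->
  exists r, 0 < r /\ forall x, In x l -> P x r.
Proof.
intros Hmono. induction l as [|x l IH]; intros H.
- exists 1. split; [lra|now intros x []].
- destruct IH as [r [Hr Hl]]; [intros y Hy; apply H; now right|].
  destruct (H x (or_introl eq_refl)) as [s [Hs Hx]].
  assert (Hm : 0 < Rmin r s) by now apply Rmin_glb_lt.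
  exists (Rmin r s). split; trivial. intros y [<-|Hy].
  + apply (Hmono x s); trivial. apply Rmin_r.
  + apply (Hmono y r); auto. apply Rmin_l.
Qed.

(** * Division, distance and small maps in a Polish group *)

Section Group.
Context (G : PolishGroup).

Local Notation d := (pg_dist G).
Local Notation mul := (pg_mul G).
Local Notation inv := (pg_inv G).
Local Notation one := (pg_one G).

Definition div (x y : G) : G := mul x (inv y).

Lemma mul_cancel_l (x y z : G) : mul x y = mul x z -> y = z.
Proof.
intros H. rewrite <- (pg_mul1l G y), <- (pg_mul1l G z), <- (pg_mulVl G x).
now rewrite <- !pg_mulA, H.
Qed.

Lemma div_diag (x : G) : div x x = one.
Proof. apply pg_mulVr. Qed.

Lemma div_mul (x y : G) : mul (div x y) y = x.
Proof. unfold div. now rewrite <- pg_mulA, pg_mulVl, pg_mul1r. Qed.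

Lemma div_eq_one (x y : G) : div x y = one -> x = y.
Proof. intros H. now rewrite <- (div_mul x y), H, pg_mul1l. Qed.

Lemma inv_one : inv one = one.
Proof. rewrite <- (pg_mul1l G (inv one)). apply pg_mulVr. Qed.

Lemma inv_unique (x y : G) : mul x y = one -> inv x = y.
Proof. intros H. apply (mul_cancel_l x). now rewrite pg_mulVr, H. Qed.

Lemma inv_mul (x y : G) : inv (mul x y) = mul (inv y) (inv x).
Proof.
apply inv_unique. rewrite <- pg_mulA, (pg_mulA G y), pg_mulVr, pg_mul1l.
apply pg_mulVr.
Qed.

Lemma inv_inv (x : G) : inv (inv x) = x.
Proof. apply inv_unique, pg_mulVl. Qed.

Lemma inv_div (x y : G) : inv (div x y) = div y x.
Proof. unfold div. now rewrite inv_mul, inv_inv. Qed.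

Lemma dist_refl (x : G) : d x x = 0.
Proof. now apply (pg_metric G). Qed.

Lemma dist_sym (x y : G) : d x y = d y x.
Proof. apply (pg_metric G). Qed.

Lemma dist_triangle (x y z : G) : d x z <= d x y + d y z.
Proof. apply (pg_metric G). Qed.

Lemma dist_pos (x y : G) : 0 <= d x y.
Proof. apply (pg_metric G). Qed.

Lemma div_cont (x y : G) (eps : R) : 0 < eps -> exists delta, 0 < delta /\
  forall x' y', d x x' < delta -> d y y' < delta -> d (div x y) (div x' y') < eps.
Proof.
intros He. destruct (pg_mul_cont G x (inv y) eps He) as [r [Hr Hmul]].
destruct (pg_inv_cont G y r Hr) as [s [Hs Hinv]].
exists (Rmin r s). split; [now apply Rmin_glb_lt|].
intros x' y' Hx Hy. pose proof (Rmin_l r s). pose proof (Rmin_r r s).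
apply Hmul; [lra|]. apply Hinv. lra.
Qed.

Lemma converges_div (u v : nat -> G) (x y : G) :
  converges d u x -> converges d v y ->
  converges d (fun n => div (u n) (v n)) (div x y).
Proof.
intros Hu Hv eps He. destruct (div_cont x y eps He) as [r [Hr Hdiv]].
destruct (Hu r Hr) as [N HN]. destruct (Hv r Hr) as [M HM].
exists (N + M)%nat. intros n Hn. rewrite dist_sym.
apply Hdiv; rewrite dist_sym; [apply HN|apply HM]; lia.
Qed.

(** If [one] were isolated, every point would equal any sufficiently close term of the dense
    sequence, which would then enumerate the group. *)
Lemma uncountable_nondiscrete (eps : R) :
  uncountable G -> 0 < eps -> exists a, a <> one /\ d one a < eps.
Proof.
intros Hunc He. apply NNPP. intros Hno. apply Hunc.
destruct (pg_separable G) as [s Hs]. exists s. intros x.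
destruct (div_cont x x eps He) as [r [Hr Hdiv]].
destruct (Hs x r Hr) as [n Hn]. exists n.
apply div_eq_one, NNPP. intros Hne. apply Hno. exists (div (s n) x).
split; trivial. rewrite <- (div_diag x). apply Hdiv; trivial.
now rewrite dist_refl.
Qed.

Fixpoint partial_prod (e : nat -> G) (n : nat) : G :=
  match n with O => one | S n => mul (partial_prod e n) (e n) end.

(** Continuity at [one] with value [one] there. *)
Definition small (phi : G -> G) : Prop :=
  forall eps, 0 < eps -> exists r, 0 < r /\
    forall a, d one a < r -> d one (phi a) < eps.

Lemma small_div (phi psi : G -> G) :
  small phi -> small psi -> small (fun a => div (phi a) (psi a)).
Proof.
intros Hphi Hpsi eps He. destruct (div_cont one one eps He) as [r [Hr Hdiv]].
destruct (Hphi r Hr) as [s [Hs H1]]. destruct (Hpsi r Hr) as [t [Ht H2]].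
exists (Rmin s t). split; [now apply Rmin_glb_lt|]. intros a Ha.
pose proof (Rmin_l s t). pose proof (Rmin_r s t).
rewrite <- (div_diag one). apply Hdiv; [apply H1|apply H2]; lra.
Qed.

Lemma small_uniform (S : list G) (Phi : list (G -> G)) (eps : R) :
  (forall phi, In phi Phi -> small phi) -> 0 < eps ->
  exists r, 0 < r /\ forall a s phi, d one a < r -> In s S -> In phi Phi ->
    d s (mul s (phi a)) < eps.
Proof.
intros HPhi He.
destruct (list_uniform_radius (fun p r => forall a, d one a < r ->
  d (fst p) (mul (fst p) (snd p a)) < eps) (list_prod S Phi)) as [r [Hr H]].
- intros p r s H Hs Hsr a Ha. apply H. lra.
- intros [s phi] Hin. apply in_prod_iff in Hin. simpl.
  destruct (pg_mul_cont G s one eps He) as [r [Hr Hmul]].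
  destruct (HPhi phi (proj2 Hin) r Hr) as [t [Ht Hphi]].
  exists t. split; trivial. intros a Ha. rewrite <- (pg_mul1r G s) at 1.
  apply Hmul; [now rewrite dist_refl|now apply Hphi].
- exists r. split; trivial. intros a s phi Ha Hs Hphi.
  apply (H (s, phi)); trivial. now apply in_prod.
Qed.

Lemma finite_gap (S : list G) :
  exists r, 0 < r /\ forall s, In s S -> s <> one -> 2 * r < d s one.
Proof.
apply (list_uniform_radius (fun s r => s <> one -> 2 * r < d s one)).
- intros s r t H Ht Htr Hs. specialize (H Hs). lra.
- intros s _. destruct (classic (s = one)) as [->|Hs].
  + exists 1. split; [lra|]. intros H. now elim H.
  + assert (H : d s one <> 0) by (intros H; apply Hs; now apply (pg_metric G)).
    pose proof (dist_pos s one). exists (d s one / 4). split; [lra|]. intros _. lra.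
Qed.

(* Each [a n] is chosen so close to [one] that the tails of all the series are
   shorter than the distance to [one] of every nontrivial partial product; a
   series with product [one] therefore has only trivial partial products. *)
Lemma lacunary_sequence (Phi : list (G -> G)) :
  uncountable G -> (forall phi, In phi Phi -> small phi) ->
  exists a : nat -> G, (forall n, a n <> one) /\
    forall e : nat -> G, (forall n, exists phi, In phi Phi /\ e n = phi (a n)) ->
      (exists z, converges d (partial_prod e) z) /\
      (forall z n, converges d (partial_prod e) z ->
         d (partial_prod e n) z <= / (INR n + 1)) /\
      (converges d (partial_prod e) one -> forall n, e n = one).
Proof.
intros Hunc HPhi.
set (next S a := map (fun p : G * (G -> G) => mul (fst p) (snd p a))
                   (list_prod S Phi)).
(* A state holds all possible partial products so far and a tolerance for the next factor. The new
   tolerance is at most half the old one and less than half the distance from [one] to any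
   nontrivial new product. *)
assert (Hstep : forall st : list G * R, exists ar : G * R, 0 < snd st ->
  fst ar <> one /\
  (forall s phi, In s (fst st) -> In phi Phi ->
     d s (mul s (phi (fst ar))) < snd st) /\
  0 < snd ar /\ snd ar <= snd st / 2 /\
  forall s, In s (next (fst st) (fst ar)) -> s <> one -> 2 * snd ar < d s one).
{ intros [S eps]. simpl. destruct (Rlt_dec 0 eps) as [He|He].
  2:{ exists (one, 0). intros H. now elim He. }
  destruct (small_uniform S Phi eps HPhi He) as [r [Hr Hclose]].
  destruct (uncountable_nondiscrete r Hunc Hr) as [a [Ha Har]].
  destruct (finite_gap (next S a)) as [t [Ht Hgap]].
  exists (a, Rmin (eps / 2) t). simpl.
  pose proof (Rmin_l (eps / 2) t). pose proof (Rmin_r (eps / 2) t).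
  intros _. split; [trivial|split; [|split; [|split; [trivial|]]]].
  - intros s phi. now apply Hclose.
  - apply Rmin_glb_lt; lra.
  - intros s Hs Hne. specialize (Hgap s Hs Hne). lra. }
apply choice in Hstep. destruct Hstep as [F HF].
(* The initial tolerance [/ 2] is the largest that [Heps_le] allows at index 0. *)
set (st := fix st n := match n with
  | O => (one :: nil, / 2)
  | S n => (next (fst (st n)) (fst (F (st n))), snd (F (st n)))
  end).
set (a n := fst (F (st n))). set (eps n := snd (st n)).
assert (Heps : forall n, 0 < eps n).
{ induction n as [|n IH]; [unfold eps; simpl; lra|]. now apply (HF (st n)). }
assert (HF' := fun n => HF (st n) (Heps n)).
assert (Hhalf : forall n, eps (S n) <= eps n / 2) by (intros n; apply (HF' n)).
assert (Heps_le : forall n, 2 * eps n <= / (INR n + 1)).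
{ induction n as [|n IH]; [unfold eps; simpl; rewrite Rplus_0_l, Rinv_1; lra|].
  pose proof (pos_INR n). specialize (Hhalf n).
  assert (/ (INR n + 1) / 2 <= / (INR (S n) + 1)); [|lra].
  rewrite S_INR. unfold Rdiv. rewrite <- Rinv_mult.
  apply Rinv_le_contravar; lra. }
assert (Hgap : forall n s, In s (fst (st n)) -> s <> one -> 2 * eps n < d s one).
{ intros [|n] s Hs Hne; [|now apply (HF' n)].
  destruct Hs as [Hs|[]]. now elim Hne. }
exists a. split; [intros n; apply (HF' n)|].
intros e He.
assert (Hin : forall n, In (partial_prod e n) (fst (st n))).
{ induction n as [|n IH]; [now left|]. simpl. apply in_map_iff.
  destruct (He n) as [phi [Hphi Hen]]. exists (partial_prod e n, phi).
  split; [simpl; now rewrite Hen|]. now apply in_prod. }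
assert (Hclose : forall n, d (partial_prod e n) (partial_prod e (S n)) < eps n).
{ intros n. destruct (He n) as [phi [Hphi Hen]]. simpl. rewrite Hen.
  now apply (HF' n). }
(* Halving gives [eps m <= 2 * eps m - 2 * eps (S m)], so the bounds on successive steps
   telescope. *)
assert (Htail : forall n m, (n <= m)%nat ->
  d (partial_prod e n) (partial_prod e m) <= 2 * eps n - 2 * eps m).
{ intros n m Hnm. induction Hnm as [|m Hnm IH]; [rewrite dist_refl; lra|].
  pose proof (dist_triangle (partial_prod e n) (partial_prod e m) (partial_prod e (S m))).
  specialize (Hclose m). specialize (Hhalf m). lra. }
assert (Hlim : forall z n, converges d (partial_prod e) z ->
  d (partial_prod e n) z <= 2 * eps n).
{ intros z n Hz. apply Rnot_lt_le. intros Hlt.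
  destruct (Hz (d (partial_prod e n) z - 2 * eps n)) as [N HN]; [lra|].
  specialize (HN (n + N)%nat ltac:(lia)). specialize (Htail n (n + N)%nat ltac:(lia)).
  pose proof (dist_triangle (partial_prod e n) (partial_prod e (n + N)) z).
  specialize (Heps (n + N)%nat). lra. }
split; [|split].
- apply pg_complete. intros r Hr. destruct (inv_INR_S_small (r / 2)) as [N HN]; [lra|].
  exists N. intros m n Hm Hn.
  pose proof (dist_triangle (partial_prod e m) (partial_prod e N) (partial_prod e n)).
  rewrite (dist_sym (partial_prod e m) (partial_prod e N)) in H.
  pose proof (Htail N m Hm). pose proof (Htail N n Hn).
  specialize (Heps_le N). pose proof (Heps m). pose proof (Heps n). lra.
- intros z n Hz. specialize (Hlim z n Hz). specialize (Heps_le n). lra.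
- intros H1.
  assert (Hone : forall n, partial_prod e n = one).
  { intros n. apply NNPP. intros Hne.
    specialize (Hlim one n H1). specialize (Hgap n _ (Hin n) Hne). lra. }
  intros n. pose proof (Hone (S n)) as H. simpl in H.
  now rewrite Hone, pg_mul1l in H.
Qed.

(** * Subproducts of a lacunary sequence in an abelian group *)

Lemma mul_div_swap (Hab : abelian G) (x y z t : G) :
  mul (div x y) (div z t) = div (mul x z) (mul y t).
Proof.
unfold div. rewrite inv_mul, (Hab (inv t)), <- !pg_mulA. f_equal.
rewrite !pg_mulA. f_equal. apply Hab.
Qed.

Lemma partial_prod_div (Hab : abelian G) (e f : nat -> G) (n : nat) :
  partial_prod (fun n => div (e n) (f n)) n = div (partial_prod e n) (partial_prod f n).
Proof.
induction n as [|n IH]; simpl; [now rewrite div_diag|].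
now rewrite IH, mul_div_swap.
Qed.

Lemma converges_partial_prod_div (Hab : abelian G) (e f : nat -> G) (x y : G) :
  converges d (partial_prod e) x -> converges d (partial_prod f) y ->
  converges d (partial_prod (fun n => div (e n) (f n))) (div x y).
Proof.
intros He Hf eps Heps.
destruct (converges_div _ _ _ _ He Hf eps Heps) as [N HN].
exists N. intros n Hn. rewrite (partial_prod_div Hab). now apply HN.
Qed.

Definition select (b : bool) (a : G) : G := if b then a else one.

Lemma small_select (b : bool) : small (select b).
Proof.
intros eps He. exists eps. split; trivial. intros a Ha.
destruct b; trivial. unfold select. now rewrite dist_refl.
Qed.

Lemma select_inj (a : G) (b c : bool) : a <> one -> select b a = select c a -> b = c.
Proof. intros Ha. destruct b, c; simpl; intros H; congruence. Qed.

Definition div_list (Phi Psi : list (G -> G)) : list (G -> G) :=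
  map (fun p a => div (fst p a) (snd p a)) (list_prod Phi Psi).

Lemma in_div_list (Phi Psi : list (G -> G)) (phi psi : G -> G) :
  In phi Phi -> In psi Psi -> In (fun a => div (phi a) (psi a)) (div_list Phi Psi).
Proof.
intros H1 H2. apply (in_map (fun p a => div (fst p a) (snd p a)) _ (phi, psi)).
now apply in_prod.
Qed.

Lemma small_div_list (Phi Psi : list (G -> G)) :
  (forall phi, In phi Phi -> small phi) -> (forall psi, In psi Psi -> small psi) ->
  forall chi, In chi (div_list Phi Psi) -> small chi.
Proof.
intros H1 H2 chi Hchi. apply in_map_iff in Hchi.
destruct Hchi as [[phi psi] [<- Hin]]. apply in_prod_iff in Hin.
apply small_div; [now apply H1|now apply H2].
Qed.

(** Moving the right-hand side over gives a series with product [one] whose terms are quotients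
    built from six selections. The lacunary sequence serves the finite list [D4] of all such
    quotients, so each term is [one]; [D1] is included for the series that define [sigma]. *)
Lemma subproduct_map (Hab : abelian G) :
  uncountable G -> exists (a : nat -> G) (sigma : cantor -> G),
    (forall n, a n <> one) /\ continuous cantor_dist d sigma /\
    forall c1 c2 c3 c4 c5 c6 : cantor,
      div (div (sigma c1) (sigma c2)) (div (sigma c3) (sigma c4)) =
        div (sigma c5) (sigma c6) ->
      forall n,
        div (div (select (c1 n) (a n)) (select (c2 n) (a n)))
            (div (select (c3 n) (a n)) (select (c4 n) (a n))) =
        div (select (c5 n) (a n)) (select (c6 n) (a n)).
Proof.
intros Hunc.
set (D1 := select true :: select false :: nil).
set (D2 := div_list D1 D1).
set (D4 := div_list (div_list D2 D2) D2).
assert (HD1 : forall b, In (select b) D1).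
{ intros [|]; [now left|right; now left]. }
assert (Hs1 : forall phi, In phi D1 -> small phi).
{ intros phi [<-|[<-|[]]]; apply small_select. }
assert (Hs2 : forall phi, In phi D2 -> small phi) by now apply small_div_list.
assert (Hs4 : forall phi, In phi D4 -> small phi).
{ apply small_div_list; trivial. now apply small_div_list. }
destruct (lacunary_sequence (D1 ++ D4) Hunc) as [a [Ha Hser]].
{ intros phi Hphi. apply in_app_iff in Hphi. destruct Hphi; auto. }
assert (Hc : forall c : cantor, forall n, exists phi,
  In phi (D1 ++ D4) /\ select (c n) (a n) = phi (a n)).
{ intros c n. exists (select (c n)). split; trivial. apply in_app_iff. now left. }
assert (Hsigma : forall c : cantor, exists z,
  converges d (partial_prod (fun n => select (c n) (a n))) z).
{ intros c. now apply Hser. }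
apply choice in Hsigma. destruct Hsigma as [sigma Hsigma].
exists a, sigma. split; [trivial|split].
- intros c eps He. destruct (inv_INR_S_small (eps / 2)) as [n Hn]; [lra|].
  exists (/ (INR n + 1)). split; [apply inv_INR_S_pos|]. intros c' Hcc'.
  apply Rlt_le, agree_cantor_dist in Hcc'.
  assert (Heq : forall m, (m <= n)%nat ->
    partial_prod (fun n => select (c n) (a n)) m =
    partial_prod (fun n => select (c' n) (a n)) m).
  { induction m as [|m IH]; trivial. intros Hm. simpl.
    rewrite IH by lia. now rewrite Hcc' by lia. }
  pose proof (proj1 (proj2 (Hser _ (Hc c))) _ n (Hsigma c)) as H1.
  pose proof (proj1 (proj2 (Hser _ (Hc c'))) _ n (Hsigma c')) as H2.
  rewrite <- Heq in H2 by trivial.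
  pose proof (dist_triangle (sigma c)
    (partial_prod (fun n => select (c n) (a n)) n) (sigma c')).
  rewrite (dist_sym (sigma c) (partial_prod _ n)) in H. lra.
- intros c1 c2 c3 c4 c5 c6 Heq n. apply div_eq_one. revert n.
  apply (Hser (fun n => div (div (div (select (c1 n) (a n)) (select (c2 n) (a n)))
            (div (select (c3 n) (a n)) (select (c4 n) (a n))))
        (div (select (c5 n) (a n)) (select (c6 n) (a n))))).
  + intros n. exists (fun a => div (div (div (select (c1 n) a) (select (c2 n) a))
            (div (select (c3 n) a) (select (c4 n) a)))
        (div (select (c5 n) a) (select (c6 n) a))).
    split; trivial. apply in_app_iff. right.
    repeat apply (in_div_list _ _ (fun a => div _ _) (fun a => div _ _));
      apply in_div_list; apply HD1.
  + rewrite <- (div_diag (div (sigma c5) (sigma c6))). rewrite <- Heq at 1.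
    repeat apply (converges_partial_prod_div Hab); apply Hsigma.
Qed.

Definition evens (c : cantor) : cantor :=
  fun n => if Nat.even n then c (Nat.div2 n) else false.

Definition odds (c : cantor) : cantor :=
  fun n => if Nat.even n then false else c (Nat.div2 n).

Lemma continuous_of_agree (f : cantor -> cantor) (g : cantor -> G) :
  (forall n x y, agree n x y -> agree n (f x) (f y)) ->
  continuous cantor_dist d g -> continuous cantor_dist d (fun x => g (f x)).
Proof.
intros Hf Hg x eps He. destruct (Hg (f x) eps He) as [r [Hr Hball]].
destruct (inv_INR_S_small r Hr) as [n Hn].
exists (/ (INR n + 1)). split; [apply inv_INR_S_pos|]. intros y Hy.
apply Hball. apply Rlt_le, agree_cantor_dist, Hf, agree_cantor_dist in Hy. lra.
Qed.

(** At odd indices the four selections coming from [p] are trivial, so the termwise identity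
    compares the bits of [y1] and [y2] alone. *)
Lemma transverse_cantor_sets (Hab : abelian G) :
  uncountable G -> exists p q : cantor -> G,
    continuous cantor_dist d p /\ continuous cantor_dist d q /\ injective p /\
    forall x1 x2 x3 x4 y1 y2,
      div (div (p x1) (p x2)) (div (p x3) (p x4)) = div (q y1) (q y2) -> y1 = y2.
Proof.
intros Hunc. destruct (subproduct_map Hab Hunc) as [a [sigma [Ha [Hcont Hrig]]]].
assert (Hdiv2 : forall n i, (i < n)%nat -> (Nat.div2 i < n)%nat).
{ intros n i Hi. pose proof (Nat.div2_decr i i). lia. }
exists (fun x => sigma (evens x)), (fun y => sigma (odds y)).
split; [|split; [|split]].
- apply continuous_of_agree; trivial. intros n x y Hxy i Hi. unfold evens.
  destruct (Nat.even i); trivial. auto.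
- apply continuous_of_agree; trivial. intros n x y Hxy i Hi. unfold odds.
  destruct (Nat.even i); trivial. auto.
- intros x y Hxy. extensionality i.
  (* The equality of two values of [p], padded with trivial quotients to the six-term form. *)
  assert (H := Hrig (evens x) (evens y) (evens y) (evens y) (evens y) (evens y)).
  rewrite Hxy, !div_diag in H. specialize (H eq_refl (2 * i)%nat).
  unfold evens in H. rewrite Nat.even_mul, Nat.div2_double in H. simpl in H.
  rewrite !div_diag in H. unfold div at 1 in H. rewrite inv_one, pg_mul1r in H.
  apply (select_inj (a (2 * i)%nat)); trivial. now apply div_eq_one.
- intros x1 x2 x3 x4 y1 y2 Heq. extensionality i.
  assert (H := Hrig _ _ _ _ _ _ Heq (S (2 * i))).
  unfold evens, odds in H.
  rewrite Nat.even_succ, Nat.odd_mul, Nat.div2_succ_double in H. simpl Nat.odd in H.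
  cbn [andb] in H.
  rewrite !div_diag in H. symmetry in H. apply div_eq_one in H.
  now apply (select_inj (a (S (2 * i)))).
Qed.

End Group.

(** * The construction *)

Lemma open_dense_ext {X : Type} (d : X -> X -> R) (U V : X -> Prop) :
  (forall x, U x <-> V x) -> open_dense d U -> open_dense d V.
Proof.
intros HUV [Ho Hdense]. split.
- intros x Vx. destruct (Ho x (proj2 (HUV x) Vx)) as [e [He Hball]].
  exists e. split; trivial. intros y Hy. now apply HUV, Hball.
- intros W HW HWne. destruct (Hdense W HW HWne) as [x [Wx Ux]].
  exists x. split; trivial. now apply HUV.
Qed.

(** This bounds the index set of the recursion by the continuum. Row 0 of the code records which
    balls about the dense sequence contain the point, and this determines the point; the other rows
    store the bit sequences. *)
Lemma polish_code (G : PolishGroup) :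
  exists code : G * (nat -> nat -> bool) -> cantor, injective code.
Proof.
destruct (pg_separable G) as [s Hs].
set (near x n m := if Rlt_dec (pg_dist G x (s n)) (/ (INR m + 1)) then true else false).
exists (fun xc k => let (i, r) := of_nat k in
  match i with
  | O => let (n, m) := of_nat r in near (fst xc) n m
  | S i => snd xc i r
  end).
intros [x c] [y c'] H.
assert (Hk : forall i r,
  match i with
  | O => let (n, m) := of_nat r in near x n m = near y n m
  | S i => c i r = c' i r
  end).
{ intros i r. pose proof (equal_f H (to_nat (i, r))) as Hir. cbv beta in Hir.
  rewrite cancel_of_to in Hir. destruct i; trivial. now destruct (of_nat r). }
f_equal.
- apply (pg_metric G). apply Rle_antisym; [|apply (dist_pos G)].
  apply Rnot_lt_le. intros Hxy.
  destruct (inv_INR_S_small (pg_dist G x y / 2)) as [m Hm]; [lra|].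
  destruct (Hs x (/ (INR m + 1))) as [n Hn]; [apply inv_INR_S_pos|].
  specialize (Hk O (to_nat (n, m))). cbv beta iota in Hk. rewrite cancel_of_to in Hk.
  unfold near in Hk.
  destruct (Rlt_dec (pg_dist G x (s n)) (/ (INR m + 1))); [|lra].
  destruct (Rlt_dec (pg_dist G y (s n)) (/ (INR m + 1))); [|easy].
  pose proof (dist_triangle G x (s n) y). rewrite (dist_sym G (s n) y) in H0. lra.
- extensionality i. extensionality r. exact (Hk (S i) r).
Qed.

Section Cancellation.
Context (G : PolishGroup) (Hab : abelian G).

Local Notation mul := (pg_mul G).

Lemma div_mul_mul_r (x y z : G) : div G (mul x z) (mul y z) = div G x y.
Proof.
rewrite <- (mul_div_swap G Hab), div_diag. apply pg_mul1r.
Qed.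

Lemma div_mul_mul_l (x y z : G) : div G (mul z x) (mul z y) = div G x y.
Proof. rewrite (Hab z x), (Hab z y). apply div_mul_mul_r. Qed.

Lemma div_div_div (x y z : G) : div G (div G z x) (div G z y) = div G y x.
Proof.
unfold div at 1. rewrite inv_div, (mul_div_swap G Hab), (Hab z y).
apply div_mul_mul_r.
Qed.

End Cancellation.

Theorem theorem3p5 (G : PolishGroup) :
  abelian G -> uncountable G ->
  exists X : G -> Prop, naively_haar_meager G X /\ ~ haar_meager G X.
Proof.
intros Hab Hunc.
destruct (transverse_cantor_sets G Hab Hunc) as [p [q [Hp [Hq [Hpinj Htrans]]]]].
assert (Hqinj : injective q).
{ intros x y Hxy. pose (o := fun _ : nat => true). apply (Htrans o o o o).
  now rewrite Hxy, !div_diag. }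
destruct (polish_code G) as [code Hcode].
set (good c := forall n : nat, open_dense cantor_dist (coded_open (c n))).
(* The sets [k + q(D)], with [c] coding [D]. When [c] is not [good] the restriction on [y] is
   dropped, so that every index still has continuum many candidates. *)
set (A := fun (i : G * (nat -> nat -> bool)) (z : G) => exists y : cantor,
  z = pg_mul G (fst i) (q y) /\
  (good (snd i) -> forall n, coded_open (snd i n) y)).
set (close := fun u v : G => exists x1 x2, div G u v = div G (p x1) (p x2)).
destruct (transversal cantor _ G code A close) as [x [HxA Hx]]; trivial.
- exact (inhabits (pg_one G)).
- intros [k c].
  assert (Hpsi : exists psi : cantor -> cantor, injective psi /\
    forall t, good c -> forall n, coded_open (c n) (psi t)).
  { destruct (classic (good c)) as [Hc|Hc].
    - destruct (cantor_embeds_comeager _ Hc) as [psi [H1 H2]].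
      exists psi. split; auto.
    - exists (fun t => t). split; [now intros s t|now intros t H]. }
  destruct Hpsi as [psi [Hinj Hpsi]].
  exists (fun t => pg_mul G k (q (psi t))). split.
  + intros s t H. now apply mul_cancel_l, Hqinj, Hinj in H.
  + intros t. exists (psi t). split; auto.
(* Dividing the two quotients [div z z1] and [div z z2] cancels [z] and then [k], leaving
   [div (q y2) (q y1)]; transversality gives equal arguments. *)
- intros [k c] z z1 z2 [y1 [-> _]] [y2 [-> _]] [x1 [x2 H12]] [x3 [x4 H34]].
  f_equal. f_equal. symmetry. simpl in *. apply (Htrans x1 x2 x3 x4).
  now rewrite <- H12, <- H34, (div_div_div G Hab), (div_mul_mul_l G Hab).
- intros u v [x1 [x2 H]]. exists x2, x1.
  now rewrite <- (inv_div G u v), H, inv_div.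
- exists (fun u => exists i, u = x i). split.
  + exists cantor, cantor_dist, p.
    split; [exact cantor_metric|split; [exact cantor_compact|split; [|split; [exact Hp|]]]].
    { exact (inhabits (fun _ => true)). }
    intros g h. apply cantor_subsingleton_meager.
    intros a b [u [[i ->] Ha]] [v [[j ->] Hb]].
    destruct (classic (i = j)) as [->|Hij].
    { apply Hpinj. now rewrite Ha, Hb. }
    (* [g] and [h] cancel in the quotient, so two points of [X] in one translate meeting [P] twice
       would be [close]. *)
    elim (Hx i j Hij). exists a, b.
    now rewrite Ha, Hb, (div_mul_mul_r G Hab), (div_mul_mul_l G Hab).
  + intros [B [HB [HXB [K [dK [f [HK [HKc [HKne [Hf Hthin]]]]]]]]]].
    destruct (borel_thin_section dK cantor_dist (pg_dist G)
      (fun r => pg_mul G (f (fst r)) (q (snd r))) B) as [k [U [HU HUB]]]; trivial.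
    * exact cantor_metric.
    * exact cantor_compact.
    * intros [k y] eps He.
      destruct (pg_mul_cont G (f k) (q y) eps He) as [r [Hr Hmul]].
      destruct (Hf k r Hr) as [s [Hs Hfk]]. destruct (Hq y r Hr) as [t [Ht Hqy]].
      exists (Rmin s t). split; [now apply Rmin_glb_lt|].
      intros [k' y'] H. unfold prod_dist in H. simpl in *.
      pose proof (Rmax_l (dK k k') (cantor_dist y y')).
      pose proof (Rmax_r (dK k k') (cantor_dist y y')).
      pose proof (Rmin_l s t). pose proof (Rmin_r s t).
      apply Hmul; [apply Hfk|apply Hqy]; lra.
    (* Membership of the product of [f k] and [q y] in [B] places [f k] in the translate of [B] by
       the inverse of [q y]. *)
    * intros y. apply (thin_subset _ _
        (fun k => translate G (pg_one G) (pg_inv G (q y)) B (f k))).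
      { intros k HBk. exists (pg_mul G (f k) (q y)). split; trivial.
        now rewrite pg_mul1l, <- pg_mulA, pg_mulVr, pg_mul1r. }
      apply meager_thin; trivial.
    * assert (Hc : forall n, exists c, forall y, coded_open c y <-> U n y).
      { intros n. apply open_coded, HU. }
      apply choice in Hc. destruct Hc as [c Hc].
      (* The point chosen for the index [(f k, c)] lies in [X], hence in [B], while its parameter
         [y] lies in every [U n], which excludes it from [B]. *)
      destruct (HxA (f k, c)) as [y [Hy Hgood]]. simpl in Hy, Hgood.
      apply (HUB y).
      { intros n. apply Hc, Hgood. intros m.
        apply (open_dense_ext _ (U m)); [|apply HU]. intros z. now rewrite Hc. }
      simpl. rewrite <- Hy. apply HXB. now exists (f k, c).
Qed.
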